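(* Let $p$ be an odd prime, $e$ a positive integer with $e\equiv2\pmod4$, $q=p^e$, and $i\in\{0,1\}$ with Legendre symbol $\left(\frac{e}{p}\right)=(-1)^i$. Let $D_i=\{x\in\mathbb{F}_q:\mathrm{Tr}(x^{p+1}-x)\in C_i^{(2,p)}\}$ and $\mathcal{C}_{D_i}=\{(\mathrm{Tr}(ax))_{x\in D_i}:a\in\mathbb{F}_q\}$. Then $\mathcal{C}_{D_i}$ has length $\frac{p-1}{2}p^{e-1}-\frac{1+\eta(-1)p}{2}p^{\frac e2-1}$ and dimension $e$, it has at most $5$ nonzero weights, and with $W=\frac{(p-1)^2}{2}p^{e-2}$ its weight distribution (weight: number of codewords) is: (a) if $p\equiv1\pmod4$: - $0$: $1$; - $W$: $p^{e-2}-1$; - $W-\frac{p+1}{2}p^{\frac e2-1}$: $\frac{p^2-1}{2}p^{e-2}-(p-1)p^{\frac e2-1}$; - $W-\frac{p+3}{2}p^{\frac e2-1}$: $\frac{(p-1)(p-3)}{4}p^{e-2}-\frac{(p-1)(p-3)}{4}p^{\frac e2-1}$; - $W-\frac{p-1}{2}p^{\frac e2-1}$: $\frac{p^2-1}{4}p^{e-2}+\frac{p^2-1}{4}p^{\frac e2-1}$; - $W-p^{\frac e2-1}$: $(p-1)p^{e-2}$; (b) if $p\equiv3\pmod4$: - $0$: $1$; - $W$: $p^{e-1}-1$; - $W+\frac{p-1}{2}p^{\frac e2-1}$: $\frac{p^2-1}{2}p^{e-2}$; - $W+\frac{p-3}{2}p^{\frac e2-1}$: $\frac{(p-1)^2}{4}p^{e-2}-\frac{(p-1)^2}{4}p^{\frac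 e2-1}$; - $W+\frac{p+1}{2}p^{\frac e2-1}$: $\frac{(p-1)^2}{4}p^{e-2}+\frac{(p-1)^2}{4}p^{\frac e2-1}$.
   Context: $\mathrm{Tr}$ is the absolute trace $\mathbb{F}_q\to\mathbb{F}_p$. $C_0^{(2,p)}$ (resp. $C_1^{(2,p)}$) is the set of squares (resp. non-squares) in $\mathbb{F}_p^*$. $\eta$ is the quadratic character of $\mathbb{F}_p^*$. $\left(\frac{\cdot}{p}\right)$ is the Legendre symbol. Weights are Hamming weights. *)

(* Defs.v *)
From mathcomp Require Import all_boot all_order all_algebra all_field.
Set Implicit Arguments. Unset Strict Implicit. Unset Printing Implicit Defensive.
Import Order.TTheory GRing.Theory Num.Theory.
Local Open Scope ring_scope.

Definition legendre (a p : nat) : int :=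
  if (p %| a)%N then 0
  else if [exists x : 'I_p, (x ^ 2 == a %[mod p])%N] then 1 else -1.

(* eta(-1): the quadratic character of F_p at -1, i.e. ((p-1)/p). *)
Definition eta_m1 (p : nat) : int := legendre p.-1 p.

Section FF.
Variables (F : finFieldType) (p e : nat).

(* absolute trace F_q -> F_p (q = p^e), values in the prime subfield of F *)
Definition Tr (x : F) : F := \sum_(j < e) x ^+ (p ^ j).

Definition in_Fp (y : F) : bool := y ^+ p == y.

Definition is_sq_Fp (y : F) : bool :=
  [&& y != 0, in_Fp y & [exists z : F, in_Fp z && (z ^+ 2 == y)]].
Definition in_C (i : bool) (y : F) : bool :=
  if i then [&& y != 0, in_Fp y & ~~ is_sq_Fp y] else is_sq_Fp y.

Definition Dset (i : bool) : {set F} :=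
  [set x : F | in_C i (Tr (x ^+ p.+1 - x))].

(* codeword attached to a: (Tr(a x))_{x in D_i}, stored as a function on F
   vanishing outside D_i *)
Definition codeword (i : bool) (a : F) : {ffun F -> F} :=
  [ffun x => if x \in Dset i then Tr (a * x) else 0].

Definition code (i : bool) : {set {ffun F -> F}} :=
  [set codeword i a | a : F].

(* Hamming weight (support lies in D_i) *)
Definition wt (c : {ffun F -> F}) : nat := #|[set x : F | c x != 0]|.

End FF.

(* Main.v *)
From HB Require Import structures.
Require Import Defs.
From mathcomp Require Import all_boot all_order all_algebra all_field.
From mathcomp Require Import cyclic ring lra zify.
Set Implicit Arguments. Unset Strict Implicit. Unset Printing Implicit Defensive.
Import Order.TTheory GRing.Theory Num.Theory.
Local Open Scope ring_scope.

(** Write Q(x) = Tr(x^(p+1)) and let B be its polar form.  Since e = 2 (mod 4),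
    Q is nondegenerate, and completing the square in the exponential sums of
    psi(y Q(x) + z B(u, x)) reduces every count to the Gauss sum of Q.  That sum
    does not depend on y (the norm is onto F_p), its square is p^e, and its sign
    is minus because the (p+1)-th roots of unity act freely on {Q = 1}.
    Hence for u <> 0 the number of x with Q(x) = c and B(u, x) = d is
    p^(e-2) + p^(e/2-1) (1 - #{z | Q(u) z^2 + d z + c = 0}).
    The shift x -> x + 1/2 turns Q(x) - Tr(x) into Q(x) - e/4, and for every a
    there is a unique u with Tr(a x) = B(u, x) for all x; so the weight of the
    codeword of a depends only on the quadratic characters of e Q(u) and
    Tr(u)^2 - e Q(u), whose joint distribution is again given by the count,
    as Tr(u) = B(1, u)/2. *)

(** * Cardinalities as sums of indicators *)

Lemma natr_card_set (R : pzSemiRingType) (T : finType) (P : pred T) :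
  #|[set x | P x]|%:R = \sum_x (P x)%:R :> R.
Proof.
rewrite -sum1_card natr_sum [LHS]big_mkcond; apply: eq_bigr => x _.
by rewrite inE; case: (P x).
Qed.

Lemma sumr_natb (R : pzSemiRingType) (T : finType) (a : T) (f : T -> R) :
  \sum_x (x == a)%:R * f x = f a.
Proof.
rewrite (bigD1 a) //= eqxx mul1r big1 ?addr0 // => x /negPf->.
by rewrite mul0r.
Qed.

Lemma sumr_fibre (S T : finType) (h : S -> T) (f : T -> rat) :
  \sum_x f (h x) = \sum_t f t * #|[set x | h x == t]|%:R.
Proof.
under [RHS]eq_bigr => t _ do rewrite natr_card_set mulr_sumr.
rewrite exchange_big; apply: eq_bigr => x _ /=.
under eq_bigr => t _ do rewrite mulrC eq_sym.
by rewrite sumr_natb.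
Qed.

(** * The quadratic character of a finite field of odd characteristic *)

Section QuadraticCharacter.
Variable K : finFieldType.
Hypothesis two_neq0 : 2 != 0 :> K.

(** In odd characteristic this is the quadratic character, extended by 0 at 0. Rational values let
    counts and character sums be mixed and halved freely. *)
Definition eta (y : K) : rat := #|[set z : K | z ^+ 2 == y]|%:R - 1.

Lemma eta0 : eta 0 = 0.
Proof.
rewrite /eta (_ : [set _ | _] = [set 0]) ?cards1 ?subrr //.
by apply/setP=> z; rewrite !inE sqrf_eq0.
Qed.

Lemma eta_sqr (c : K) : c != 0 -> eta (c ^+ 2) = 1.
Proof.
move=> c0; rewrite /eta (_ : [set _ | _] = [set c; - c]).
  rewrite cards2 (_ : c != - c) //.
  by rewrite -subr_eq0 opprK -mulr2n -mulr_natl mulf_neq0.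
by apply/setP=> z; rewrite !inE eqf_sqr.
Qed.

Lemma eta1 : eta 1 = 1.
Proof. by rewrite -(expr1n _ 2) eta_sqr ?oner_neq0. Qed.

Variant eta_spec (y : K) : rat -> Prop :=
  | EtaZero of y = 0 : eta_spec y 0
  | EtaSquare c of c != 0 & y = c ^+ 2 : eta_spec y 1
  | EtaNonSquare of y != 0 & (forall z, z ^+ 2 != y) : eta_spec y (-1).

Lemma etaP y : eta_spec y (eta y).
Proof.
have [->|y0] := eqVneq y 0; first by rewrite eta0; apply: EtaZero.
have [/existsP[c /eqP cy]|nsq] := boolP [exists z : K, z ^+ 2 == y].
  have c0 : c != 0 by apply: contra_neq y0 => c0; rewrite -cy c0 expr0n.
  by rewrite -cy eta_sqr //; apply: EtaSquare c0 _.
have nsqy z : z ^+ 2 != y by move: nsq; rewrite negb_exists => /forallP.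
rewrite /eta (_ : [set _ | _] = set0) ?cards0 ?sub0r; first exact: EtaNonSquare.
by apply/setP=> z; rewrite !inE (negPf (nsqy z)).
Qed.

Lemma eta_eq0 y : (eta y == 0) = (y == 0).
Proof.
case: etaP => [->|c c0 ->|/negPf-> _]; rewrite ?eqxx //.
by rewrite sqrf_eq0 (negPf c0).
Qed.

Lemma eta_mul_sqr c y : c != 0 -> eta (c ^+ 2 * y) = eta y.
Proof.
move=> c0; case: (etaP y) => [->|d d0 ->|y0 nsq]; first by rewrite mulr0 eta0.
  by rewrite -exprMn eta_sqr ?mulf_neq0.
case: etaP => // [/eqP|d d0 def_y].
  by rewrite mulf_eq0 sqrf_eq0 (negPf c0) (negPf y0).
case/eqP: (nsq (d / c)); rewrite exprMn -def_y exprVn mulrAC mulfV ?mul1r //.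
by rewrite sqrf_eq0.
Qed.

Lemma sum_comp_sqr (f : K -> rat) :
  \sum_t f (t ^+ 2) = \sum_s (1 + eta s) * f s.
Proof.
rewrite (eq_bigr (fun t => \sum_s (s == t ^+ 2)%:R * f s)); last first.
  by move=> t _; rewrite sumr_natb.
rewrite exchange_big; apply: eq_bigr => s _ /=.
rewrite -mulr_suml /eta subrKC natr_card_set; congr (_ * _).
by apply: eq_bigr => t _; rewrite eq_sym.
Qed.

Lemma sum_eta : \sum_y eta y = 0.
Proof.
have := sum_comp_sqr (fun=> 1); under [RHS]eq_bigr => s _ do rewrite mulr1.
by rewrite big_split /= -[LHS]addr0 => /addrI.
Qed.

Lemma sum_eta_inj (f : K -> K) : injective f -> \sum_y eta (f y) = 0.
Proof.
by move=> f_inj; rewrite -[RHS]sum_eta [RHS](reindex_inj f_inj).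
Qed.

(* For a nonsquare c, every term of the vanishing sum of eta (c y) + eta y
   is nonpositive, so each of them is zero. *)
Lemma etaM x y : eta (x * y) = eta x * eta y.
Proof.
case: (etaP x) => [->|c c0 ->|x0 nsq]; first by rewrite mul0r eta0 mul0r.
  by rewrite mul1r eta_mul_sqr.
have h_le0 z : eta (x * z) + eta z <= 0.
  case: (etaP z) => [->|d d0 ->|z0 nz]; first by rewrite mulr0 eta0.
    rewrite mulrC eta_mul_sqr //; case: etaP => // [|c c0 def_x] //.
      by move=> x0'; rewrite x0' eqxx in x0.
    by case/eqP: (nsq c).
  by case: etaP.
have/eqP : \sum_z - (eta (x * z) + eta z) = 0.
  by rewrite sumrN big_split /= sum_eta sum_eta_inj ?addr0 ?oppr0 //; apply: mulfI.
rewrite psumr_eq0 => [/allP/(_ y)|z _]; last by rewrite oppr_ge0.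
by rewrite mem_index_enum oppr_eq0 addr_eq0 mulN1r => /(_ isT)/eqP.
Qed.

Lemma sumr_neq0 (c : rat) : \sum_(s : K | s != 0) c = (#|K|%:R - 1) * c.
Proof.
rewrite sumr_const -[LHS]mulr_natl; congr (_ * _).
rewrite [in RHS](cardD1 (0 : K)) inE natrD addrAC subrr add0r.
by congr (_%:R); apply: eq_card => s; rewrite !inE andbT.
Qed.

(** Summing over [s = t ^+ 2] leaves the sum of [eta s * eta (s - d)]. For [s != 0] this term is
    [eta (1 - d / s)], and [1 - d / s] takes every value except 1. *)
Lemma sum_eta_sqr_sub d :
  \sum_t eta (t ^+ 2 - d) = if d == 0 then #|K|%:R - 1 else -1.
Proof.
rewrite (sum_comp_sqr (fun s => eta (s - d))).
case: eqP => [->|/eqP d0].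
  under eq_bigr => s _ do rewrite subr0 mulrDl mul1r -expr2.
  rewrite big_split /= sum_eta add0r (bigD1 0) //= eta0 expr0n add0r.
  rewrite (eq_bigr (fun=> 1)); last first.
    by move=> s s0; case: etaP => // s0'; rewrite s0' eqxx in s0.
  by rewrite sumr_neq0 mulr1.
under eq_bigr => s _ do rewrite mulrDl mul1r.
rewrite big_split /= sum_eta_inj ?add0r; last exact: subIr.
(* As [0^-1 = 0], this map is a permutation of all of [K]; the value 1 omitted above is its value at
   [s = 0]. *)
have inj_f : injective (fun s => 1 - d * s^-1).
  by move=> s t /(addrI 1)/oppr_inj/(mulfI d0)/invr_inj.
have := sum_eta_inj inj_f; rewrite (bigD1 0) //= invr0 mulr0 subr0 eta1.
move=> /eqP; rewrite addrC addr_eq0 => /eqP <-.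
rewrite (bigD1 0) //= eta0 mul0r add0r; apply: eq_bigr => s s0.
by rewrite -etaM -[RHS](eta_mul_sqr _ s0); congr eta; field.
Qed.

Lemma sum_nateq0_eta (f : K -> rat) :
  \sum_y (1 - eta y ^+ 2) * f y = f 0.
Proof.
rewrite -[RHS]sumr_natb; apply: eq_bigr => y _; congr (_ * _).
by case: etaP => [->|c c0 ->|/negPf-> _]; rewrite ?eqxx ?sqrf_eq0 ?(negPf c0).
Qed.

Let cK : rat := #|K|%:R.

Lemma sum_eta2 : \sum_y eta y ^+ 2 = cK - 1.
Proof.
have := sum_nateq0_eta (fun=> 1); under eq_bigr => y _ do rewrite mulr1.
by rewrite big_split /= sumrN sumr_const => <-; rewrite opprB addrC subrK.
Qed.

(** On values in {-1, 0, 1}, [g] is a combination of the nine monomials of degree at most 2 in each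
    variable, so their sums suffice; [v -> T ^+ 2 - v] swaps the two variables. The pairs (0, -1)
    and (-1, 0) are absent: if one of [v] and [T ^+ 2 - v] is 0, the other is a square. *)
Lemma sum_eta_pairs (g : rat -> rat -> rat) :
  \sum_T \sum_v g (eta v) (eta (T ^+ 2 - v)) =
    g 0 0 + (cK - 1) * (g 0 1 + g 1 0)
    + (cK - 1) * (cK - 3) / 4 * g 1 1
    + (cK - 1) ^+ 2 / 4 * (g 1 (-1) + g (-1) 1)
    + (cK ^+ 2 - 1) / 4 * g (-1) (-1).
Proof.
pose Sm (f : rat -> rat -> rat) := \sum_T \sum_v f (eta v) (eta (T ^+ 2 - v)).
have SmD f1 f2 : Sm (fun a b => f1 a b + f2 a b) = Sm f1 + Sm f2.
  by rewrite /Sm -big_split; apply: eq_bigr => T _; rewrite -big_split.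
have SmZ c f : Sm (fun a b => c * f a b) = c * Sm f.
  by rewrite /Sm mulr_sumr; apply: eq_bigr => T _; rewrite mulr_sumr.
have flip f : Sm f = Sm (fun a b => f b a).
  rewrite /Sm; apply: eq_bigr => T _.
  rewrite (reindex_inj (can_inj (subKr (T ^+ 2)))) /=.
  by apply: eq_bigr => v _; rewrite subKr.
have at0 (f : rat -> rat) :
    Sm (fun a b => (1 - a ^+ 2) * f b) = \sum_T f (eta (T ^+ 2)).
  rewrite /Sm; apply: eq_bigr => T _.
  by rewrite (sum_nateq0_eta (fun v => f (eta (T ^+ 2 - v)))) subr0.
have sq1 (f : rat -> rat) : \sum_T f (eta (T ^+ 2)) = f 0 + (cK - 1) * f 1.
  rewrite (bigD1 0) //= expr0n eta0; congr (_ + _).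
  rewrite (eq_bigr (fun=> f 1)) => [|T T0]; last by rewrite eta_sqr.
  by rewrite sumr_neq0.
have S0 : Sm (fun _ _ => 1) = cK ^+ 2.
  rewrite /Sm; under eq_bigr => T _ do rewrite sumr_const.
  by rewrite sumr_const -mulr_natl expr2.
have Sa : Sm (fun a _ => a) = 0.
  by rewrite /Sm big1 // => T _; apply: sum_eta.
have Sa2 : Sm (fun a _ => a ^+ 2) = cK * (cK - 1).
  rewrite /Sm (eq_bigr (fun=> cK - 1)) => [|T _]; last exact: sum_eta2.
  by rewrite sumr_const mulr_natl.
have Sab : Sm (fun a b => a * b) = 0.
  rewrite /Sm exchange_big (eq_bigr (fun v => - eta v)) /=; last first.
    move=> v _; rewrite -mulr_sumr sum_eta_sqr_sub.
    by case: eqP => [->|_]; rewrite ?eta0 ?mul0r ?oppr0 ?mulrN1.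
  by rewrite sumrN sum_eta oppr0.
have Sb : Sm (fun _ b => b) = 0 by rewrite flip.
have Sb2 : Sm (fun _ b => b ^+ 2) = cK * (cK - 1) by rewrite flip.
have Sa2b : Sm (fun a b => a ^+ 2 * b) = - (cK - 1).
  have : Sm (fun a b => 1 * b) = Sm (fun a b => (1 - a ^+ 2) * b + a ^+ 2 * b).
    by rewrite /Sm; apply: eq_bigr => T _; apply: eq_bigr => v _; ring.
  by rewrite SmD (at0 id) (sq1 id) SmZ Sb => H; lra.
have Sab2 : Sm (fun a b => b ^+ 2 * a) = - (cK - 1) by rewrite flip.
have Sa2b2 : Sm (fun a b => a ^+ 2 * b ^+ 2) = (cK - 1) ^+ 2.
  have : Sm (fun a b => 1 * b ^+ 2) =
         Sm (fun a b => (1 - a ^+ 2) * b ^+ 2 + a ^+ 2 * b ^+ 2).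
    by rewrite /Sm; apply: eq_bigr => T _; apply: eq_bigr => v _; ring.
  by rewrite SmD (at0 (fun b => b ^+ 2)) (sq1 (fun b => b ^+ 2)) SmZ Sb2 => H; lra.
(* Interpolation at 0, 1, -1: [P1] is the coefficient of degree 2 and [P2] that of degree 1. *)
pose P1 x y z := (y + z - 2 * x) / 2 : rat.
pose P2 y z := (y - z) / 2 : rat.
pose c2 b := P1 (g 0 b) (g 1 b) (g (-1) b).
pose c1 b := P2 (g 1 b) (g (-1) b).
have -> : \sum_T \sum_v g (eta v) (eta (T ^+ 2 - v)) =
  Sm (fun a b => g 0 0 * 1 + (c1 0 * a + (c2 0 * a ^+ 2 +
     (P2 (g 0 1) (g 0 (-1)) * b + (P2 (c1 1) (c1 (-1)) * (a * b) +
      (P2 (c2 1) (c2 (-1)) * (a ^+ 2 * b) +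
      (P1 (g 0 0) (g 0 1) (g 0 (-1)) * b ^+ 2 +
      (P1 (c1 0) (c1 1) (c1 (-1)) * (b ^+ 2 * a) +
       P1 (c2 0) (c2 1) (c2 (-1)) * (a ^+ 2 * b ^+ 2))))))))).
  apply: eq_bigr => T _; apply: eq_bigr => v _; rewrite /c1 /c2 /P1 /P2.
  by case: (etaP v) => [_|c _ _|_ _]; case: etaP => [_|d _ _|_ _]; field.
rewrite !(SmD, SmZ) S0 Sa Sa2 Sb Sab Sa2b Sb2 Sab2 Sa2b2 /c1 /c2 /P1 /P2.
by field.
Qed.

(* The substitution z = 1/t turns the reversed polynomial into a monic one. *)
Lemma sum_eta_quadratic (G : rat -> rat) v T :
  \sum_z G (eta (v * z ^+ 2 + 2 * T * z + 1)) =
  G 1 - G (eta v) + \sum_t G (eta (t ^+ 2 - (T ^+ 2 - v))).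
Proof.
rewrite (reindex_inj (@invr_inj K)) /= (bigD1 0) //= invr0.
rewrite expr0n !mulr0 !add0r eta1 -addrA; congr (_ + _).
rewrite [in RHS](reindex_inj (addIr T)) /= [in RHS](bigD1 0) //=.
rewrite add0r subKr addKr; apply: eq_bigr => t t0.
rewrite -(eta_mul_sqr (v * t^-1 ^+ 2 + 2 * T * t^-1 + 1) t0).
by congr (G (eta _)); field.
Qed.

Lemma card_eta_quadratic v T :
  #|[set z | eta (- (v * z ^+ 2 + 2 * T * z + 1)) == 1]|%:R =
  (cK - eta (T ^+ 2 - v) - eta v ^+ 2
   + eta (-1) * (cK * (eta (T ^+ 2 - v) == 0)%:R - eta v)) / 2.
Proof.
rewrite natr_card_set.
(* The indicator of a character value 1 is half of the character plus its square; multiplicativity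
   extracts [eta (-1)]. *)
have ind y : (eta (- y) == 1)%:R = (eta y ^+ 2 + eta (-1) * eta y) / 2 :> rat.
  rewrite -[- y]mulN1r etaM; case: (etaP y) => [_|c _ _|_ _];
    by case: (etaP (-1)) => [/eqP|d _ _|_ _]; rewrite ?oppr_eq0 ?oner_eq0.
under eq_bigr => z _ do rewrite ind.
rewrite -mulr_suml big_split /= -mulr_sumr.
rewrite (sum_eta_quadratic (fun x => x ^+ 2)) (sum_eta_quadratic id).
set d := T ^+ 2 - v; rewrite sum_eta_sqr_sub eta_eq0.
rewrite (sum_comp_sqr (fun s => eta (s - d) ^+ 2)).
(* The factor [eta (s - d) ^+ 2] only removes the term [s = d], which is [1 + eta d]. *)
have -> : \sum_s (1 + eta s) * eta (s - d) ^+ 2 = cK - 1 - eta d.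
  under eq_bigr => s _ do rewrite mulrDl mul1r.
  rewrite big_split /= -sum_eta2 [X in _ = X - _](reindex_inj (addIr (- d))) /=.
  congr (_ + _).
  have := sum_nateq0_eta (fun s => eta (s + d)).
  rewrite add0r => <-; rewrite -sumrN (reindex_inj (addIr d)) /=.
  rewrite -[LHS]subr0 -[X in _ - X](sum_eta_inj (addIr d)) -sumrB.
  by apply: eq_bigr => s _; rewrite addrK; ring.
by case: (d == 0); rewrite /cK /= ?mulr0n ?mulr1n; field.
Qed.

Lemma card_eta1 : #|[set y | eta y == 1]|%:R = (cK - 1) / 2.
Proof.
rewrite natr_card_set -sum_eta2 -[\sum_y _ ^+ 2]addr0 -[X in _ + X]sum_eta.
rewrite -big_split mulr_suml; apply: eq_bigr => y _.
by case: etaP.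
Qed.

End QuadraticCharacter.

(** * The prime field and its additive character *)

Lemma leq_card_roots (R : finFieldType) (q : {poly R}) :
  q != 0 -> (#|[set x | root q x]| < size q)%N.
Proof.
move=> q0; rewrite cardE; apply: max_poly_roots q0 _ (enum_uniq _).
by apply/allP=> x; rewrite mem_enum inE.
Qed.

Section PrimeField.
Variable p : nat.
Hypotheses (p_pr : prime p) (p_odd : odd p).

Lemma natr_Fp (a : 'F_p) : (a : nat)%:R = a.
Proof. exact: natr_Zp. Qed.

Lemma eqr_Fp (m n : nat) : (m%:R == n%:R :> 'F_p) = (m == n %[mod p]).
Proof. by rewrite -val_eqE /= !val_Fp_nat. Qed.

Lemma Fp_two_neq0 : 2 != 0 :> 'F_p.
Proof.
rewrite -(dvdn_pcharf (pchar_Fp p_pr)); apply/negP=> /(@dvdn_leq p 2 isT).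
by case: p p_pr p_odd => [|[|[|]]].
Qed.

Lemma eta_legendre a : eta (a%:R : 'F_p) = (legendre a p)%:~R.
Proof.
have p_gt0 := prime_gt0 p_pr.
rewrite /legendre (dvdn_pcharf (pchar_Fp p_pr)).
have eq_sqr x : ((x ^ 2 == a %[mod p])%N) = (x%:R ^+ 2 == a%:R :> 'F_p).
  by rewrite -natrX eqr_Fp.
case: (etaP Fp_two_neq0 a%:R) => [->|c c0 def_a|/negPf-> nsq]; first by rewrite eqxx.
  rewrite def_a sqrf_eq0 (negPf c0); case: existsP => // [[]].
  (* The bound of the ordinal type ['F_p] is not syntactically [p]; reducing modulo [p] yields an
     element of ['I_p]. *)
  exists (Ordinal (ltn_pmod c p_gt0)).
  by rewrite eq_sqr /= Fp_nat_mod // natr_Fp def_a.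
by case: existsP => // [[x]]; rewrite eq_sqr (negPf (nsq _)).
Qed.

Lemma expf_Fp (a : 'F_p) : a ^+ p = a.
Proof. by rewrite -{2}[a]expf_card card_Fp. Qed.

Lemma expf_Fp_pred (a : 'F_p) : a != 0 -> a ^+ p.-1 = 1.
Proof.
move=> a0; apply: (mulfI a0); rewrite -exprS prednK ?prime_gt0 //.
by rewrite expf_Fp mulr1.
Qed.

Lemma Fp_m1_neq1 : -1 != 1 :> 'F_p.
Proof. by rewrite eq_sym -subr_eq0 opprK Fp_two_neq0. Qed.

(** If [p = 4n + 1], then [X^(2n) - 1] has too few roots to kill all nonzero elements, so some
    [a ^+ (2 * n)] is -1, the square of [a ^+ n]. Otherwise [p - 1] is twice an odd number, and a
    root [c] of -1 would give [c ^+ p.-1 = -1]. *)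
Lemma eta_Fp_m1 : eta (-1 : 'F_p) = if (p %% 4 == 1)%N then 1 else -1.
Proof.
have p_gt1 := prime_gt1 p_pr.
case: eqP => p4.
  have [n def_p] : {n | p = (4 * n).+1}.
    by exists (p %/ 4)%N; rewrite {1}(divn_eq p 4) p4 addn1 mulnC.
  have n_gt0 : (0 < n)%N by lia.
  have [a] : exists a : 'F_p, (a != 0) && (a ^+ (2 * n) != 1).
    apply/existsP; apply: contraT; rewrite negb_exists => /forallP all1.
    have q0 : ('X^(2 * n) - 1 : {poly 'F_p}) != 0.
      by rewrite -size_poly_eq0 size_XnsubC; lia.
    have := leq_card_roots q0; rewrite size_XnsubC ?ltnS; last by lia.
    rewrite leqNgt => /negP[]; apply: (@leq_trans #|[set~ (0 : 'F_p)]|).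
      by rewrite cardsC1 card_Fp //; lia.
    apply: subset_leq_card; apply/subsetP=> a; rewrite !inE => a0.
    have := all1 a; rewrite a0 negbK => /eqP a1.
    by rewrite /root !hornerE a1 subrr.
  case/andP=> a0 a1; have : (a ^+ (2 * n)) ^+ 2 == 1 ^+ 2.
    by rewrite expr1n -exprM (_ : (2 * n * 2)%N = p.-1) ?expf_Fp_pred //; lia.
  rewrite eqf_sqr (negPf a1) /= mulnC exprM => /eqP <-.
  by rewrite (eta_sqr Fp_two_neq0) ?expf_neq0.
case: (etaP Fp_two_neq0 (-1)) => // [/eqP|c c0 def_m1].
  by rewrite oppr_eq0 oner_eq0.
have := expf_Fp_pred c0; have -> : p.-1 = (2 * (p %/ 4).*2.+1)%N by lia.
rewrite exprM -def_m1 exprS -mul2n exprM sqrrN !expr1n mulr1 => /eqP.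
by rewrite (negPf Fp_m1_neq1).
Qed.

Lemma eta_m1E : (eta_m1 p)%:~R = eta (-1 : 'F_p).
Proof.
rewrite -eta_legendre; congr eta; apply/eqP.
rewrite -subr_eq0 opprK natr1 prednK ?prime_gt0 //.
by rewrite -(dvdn_pcharf (pchar_Fp p_pr)).
Qed.

Variable zeta : algC.
Hypothesis zeta_prim : p.-primitive_root zeta.

Definition psi (a : 'F_p) : algC := zeta ^+ a.

Lemma psi0 : psi 0 = 1. Proof. by []. Qed.

Lemma psi1_neq1 : psi 1 != 1.
Proof.
rewrite /psi (_ : (1 : 'F_p) = 1%N :> nat); last first.
  by rewrite -[1]/(1%:R) val_Fp_nat // modn_small ?prime_gt1.
by rewrite (eq_prim_root_expr zeta_prim 1 0) mod0n modn_small ?prime_gt1.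
Qed.

Lemma psiD a b : psi (a + b) = psi a * psi b.
Proof.
rewrite /psi -exprD -[RHS](prim_expr_mod zeta_prim) -val_Fp_nat //.
by rewrite natrD !natr_Fp.
Qed.

(** Translation by [t0] multiplies the sum by [psi 1], which is not 1. *)
Lemma sum_psi_eq0 (T : finZmodType) (f : T -> 'F_p) t0 :
  (forall x, f (x + t0) = f x + 1) -> \sum_x psi (f x) = 0.
Proof.
move=> ft0; have : \sum_x psi (f x) = (\sum_x psi (f x)) * psi 1.
  rewrite {1}(reindex_inj (addIr t0)) mulr_suml; apply: eq_bigr => x _ /=.
  by rewrite ft0 psiD.
move/eqP; rewrite -subr_eq0 -{1}[\sum_x _]mulr1 -mulrBr mulf_eq0 => /orP[/eqP//|].
by rewrite subr_eq0 eq_sym (negPf psi1_neq1).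
Qed.

Lemma sum_psi t : \sum_y psi (y * t) = p%:R * (t == 0)%:R.
Proof.
case: eqP => [->|/eqP t0].
  under eq_bigr => y _ do rewrite mulr0.
  by rewrite sumr_const card_Fp // mulr1.
rewrite mulr0; apply: (@sum_psi_eq0 _ _ t^-1) => y.
by rewrite mulrDl mulVf.
Qed.

End PrimeField.

(** * The embedding of the prime field *)

Definition Fp_incl (R : nzRingType) (p : nat) (charRp : p \in [pchar R])
  (a : 'F_p) : R := (a : nat)%:R.

Section PrimeFieldInclusion.
Variables (R : nzRingType) (p : nat).
Hypothesis charRp : p \in [pchar R].
Let p_pr : prime p := pcharf_prime charRp.
Local Notation iota := (Fp_incl charRp).

Lemma Fp_incl_nat n : iota n%:R = n%:R.
Proof. by rewrite /Fp_incl val_Fp_nat // (GRing.natr_mod_pchar charRp). Qed.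

Lemma Fp_incl_zmod_morphism : zmod_morphism iota.
Proof.
move=> a b; apply/eqP; rewrite eq_sym subr_eq; apply/eqP.
rewrite -[a in LHS](subrK b) -[a - b in LHS]natr_Fp -[b in LHS]natr_Fp.
by rewrite -natrD Fp_incl_nat natrD -!Fp_incl_nat !natr_Fp.
Qed.

Lemma Fp_incl_monoid_morphism : monoid_morphism iota.
Proof.
split=> [|a b]; first exact: (Fp_incl_nat 1).
by rewrite -[a in LHS]natr_Fp -[b in LHS]natr_Fp -natrM Fp_incl_nat natrM.
Qed.

HB.instance Definition _ := GRing.isZmodMorphism.Build _ _ iota Fp_incl_zmod_morphism.
HB.instance Definition _ := GRing.isMonoidMorphism.Build _ _ iota Fp_incl_monoid_morphism.

End PrimeFieldInclusion.

(** * The quadratic form Tr(x^(p+1)) *)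

Section FieldExtension.
Variables (F : finFieldType) (p e : nat).
Hypotheses (charFp : p \in [pchar F]) (p_odd : odd p) (e_gt0 : (0 < e)%N).
Hypothesis cardF : #|F| = (p ^ e)%N.
Let p_pr : prime p := pcharf_prime charFp.
Local Notation iota := (Fp_incl charFp).
Local Notation Tr := (@Defs.Tr F p e).

Lemma exprDp (x y : F) n : (x + y) ^+ (p ^ n) = x ^+ (p ^ n) + y ^+ (p ^ n).
Proof.
apply: exprDn_pchar; rewrite (eq_pnat _ (pcharf_eq charFp)).
by rewrite pnatX pnat_id.
Qed.

Lemma exprDp1 (x y : F) : (x + y) ^+ p = x ^+ p + y ^+ p.
Proof. by have := exprDp x y 1; rewrite expn1. Qed.

Lemma expf_q (x : F) : x ^+ (p ^ e) = x.
Proof. by rewrite -cardF expf_card. Qed.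

Lemma iota_inj : injective iota.
Proof. exact: fmorph_inj. Qed.

Lemma iota0 : iota 0 = 0. Proof. exact: rmorph0. Qed.
Lemma iota1 : iota 1 = 1. Proof. exact: rmorph1. Qed.
Lemma iotaN1 : iota (-1) = -1. Proof. exact: rmorphN1. Qed.
Lemma iotaD a b : iota (a + b) = iota a + iota b. Proof. exact: rmorphD. Qed.
Lemma iotaM a b : iota (a * b) = iota a * iota b. Proof. exact: rmorphM. Qed.
Lemma iotaX a n : iota (a ^+ n) = iota a ^+ n. Proof. exact: rmorphXn. Qed.
Lemma iota_eq0 a : (iota a == 0) = (a == 0). Proof. exact: fmorph_eq0. Qed.

Lemma iota_expp a : iota a ^+ p = iota a.
Proof. by rewrite -iotaX expf_Fp. Qed.

Lemma iota_exppn a n : iota a ^+ (p ^ n) = iota a.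
Proof. by elim: n => [|n IHn]; rewrite ?expr1 // expnSr exprM IHn iota_expp. Qed.

(** The image of [iota] already supplies [p] roots of [X^p - X], so there are no others. *)
Lemma in_FpP (y : F) : reflect (exists a, y = iota a) (in_Fp p y).
Proof.
have -> : in_Fp p y = (y \in [set iota a | a : 'F_p]).
  suff -> : [set iota a | a : 'F_p] = [set y | in_Fp p y] by rewrite inE.
  apply/eqP; rewrite eqEcard; apply/andP; split.
    by apply/subsetP=> _ /imsetP[a _ ->]; rewrite inE /in_Fp iota_expp.
  rewrite card_imset ?card_Fp //; last exact: iota_inj.
  have sz : size ('X^p - 'X : {poly F}) = p.+1.
    by rewrite size_polyDl size_polyXn ?size_polyN ?size_polyX ?ltnS ?prime_gt1.
  have q0 : ('X^p - 'X : {poly F}) != 0 by rewrite -size_poly_eq0 sz.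
  have := leq_card_roots q0; rewrite sz ltnS; apply: leq_trans.
  apply: subset_leq_card; apply/subsetP=> z; rewrite !inE => /eqP zp.
  by rewrite /root !hornerE zp subrr.
by apply: (iffP imsetP) => [[a _ ->]|[a ->]]; exists a.
Qed.

Lemma TrD x y : Tr (x + y) = Tr x + Tr y.
Proof. by rewrite -big_split; apply: eq_bigr => j _; rewrite exprDp. Qed.

Lemma Tr_expp x : Tr (x ^+ p) = Tr x.
Proof.
rewrite /Defs.Tr; case: e e_gt0 expf_q => // n _ xq.
rewrite big_ord_recr big_ord_recl /= -exprM -expnS xq expr1 addrC; congr (_ + _).
by apply: eq_bigr => j _; rewrite -exprM -expnS.
Qed.

Lemma Tr_in_Fp x : in_Fp p (Tr x).
Proof.
apply/eqP; rewrite -[RHS]Tr_expp /Defs.Tr.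
elim/big_ind2: _ => [|a b c d <- <-|j _]; rewrite ?exprDp1 //.
  by rewrite expr0n; case: p p_pr.
by rewrite -!exprM mulnC.
Qed.

Definition tr (x : F) : 'F_p := odflt 0 [pick a | iota a == Tr x].

Lemma iota_tr x : iota (tr x) = Tr x.
Proof.
rewrite /tr; case: pickP => [a /eqP//|noa].
by case/in_FpP: (Tr_in_Fp x) => a /esym/eqP; rewrite noa.
Qed.

Lemma trD x y : tr (x + y) = tr x + tr y.
Proof. by apply: iota_inj; rewrite iotaD !iota_tr TrD. Qed.

Lemma trZ a x : tr (iota a * x) = a * tr x.
Proof.
apply: iota_inj; rewrite iotaM !iota_tr /Defs.Tr mulr_sumr.
by apply: eq_bigr => j _; rewrite exprMn iota_exppn.
Qed.

Lemma tr0 : tr 0 = 0.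
Proof. by have := trZ 0 0; rewrite iota0 !mul0r. Qed.

Lemma trN x : tr (- x) = - tr x.
Proof. by rewrite -mulN1r -iotaN1 trZ mulN1r. Qed.

Lemma tr_expp x : tr (x ^+ p) = tr x.
Proof. by apply: iota_inj; rewrite !iota_tr Tr_expp. Qed.

Lemma tr_exppn x n : tr (x ^+ (p ^ n)) = tr x.
Proof. by elim: n => [|n IHn]; rewrite ?expr1 // expnSr exprM tr_expp. Qed.

Lemma tr1 : tr 1 = e%:R.
Proof.
apply: iota_inj; rewrite iota_tr /Defs.Tr Fp_incl_nat.
under eq_bigr => j _ do rewrite expr1n.
by rewrite sumr_const card_ord.
Qed.

(** As a polynomial the trace is nonzero, its coefficient of [X] being 1, and its degree is at most
    [p ^ e.-1], so it cannot vanish on all of [F]; then rescale. *)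
Lemma tr_eq1 : exists x, tr x = 1.
Proof.
have [x tr_x] : exists x, tr x != 0.
  apply/existsP; apply: contraT; rewrite negb_exists => /forallP all0.
  pose q : {poly F} := \sum_(j < e) 'X^(p ^ j).
  have q_1 : q`_1 = 1.
    rewrite /q coef_sum (bigD1 (Ordinal e_gt0)) //= coefXn eqxx.
    rewrite big1 ?addr0 // => j; rewrite coefXn -val_eqE /= => j0.
    by rewrite eq_sym -(expn0 p) eqn_exp2l ?prime_gt1 // (negPf j0).
  have q0 : q != 0 by apply: contra_eq_neq q_1 => ->; rewrite coef0 eq_sym oner_eq0.
  have sz_q : (size q <= (p ^ e.-1).+1)%N.
    apply: (leq_trans (size_sum _ _ _)); apply/bigmax_leqP => j _.
    rewrite size_polyXn ltnS leq_exp2l ?prime_gt1 //; have := ltn_ord j; lia.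
  have := leq_trans (leq_card_roots q0) sz_q; rewrite ltnS leqNgt => /negP[].
  rewrite (_ : [set _ | _] = [set: F]); last first.
    apply/setP=> x; rewrite !inE /root horner_sum.
    under eq_bigr => j _ do rewrite hornerXn.
    by rewrite -/(Defs.Tr p e x) -iota_tr (eqP (negbNE (all0 x))) iota0 eqxx.
  by rewrite cardsT cardF ltn_exp2l ?prime_gt1 //; lia.
by exists (iota (tr x)^-1 * x); rewrite trZ mulVf.
Qed.

(** * The quadratic form and its polarization *)

Definition quad (x : F) : 'F_p := tr (x ^+ p.+1).
Definition bil (x y : F) : 'F_p := tr (x ^+ p * y + x * y ^+ p).

Lemma quadD x y : quad (x + y) = quad x + quad y + bil x y.
Proof.
rewrite /quad /bil -!trD exprS exprDp1; congr tr; rewrite !exprS; ring.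
Qed.

Lemma quadZ a x : quad (iota a * x) = a ^+ 2 * quad x.
Proof. by rewrite /quad exprMn exprS iota_expp -expr2 -iotaX trZ. Qed.

Lemma quad0 : quad 0 = 0.
Proof. by rewrite /quad expr0n tr0. Qed.

Lemma quad1 : quad 1 = e%:R.
Proof. by rewrite /quad expr1n tr1. Qed.

Lemma bilC x y : bil x y = bil y x.
Proof. by rewrite /bil addrC; congr tr; congr (_ + _); rewrite mulrC. Qed.

Lemma bilDr x y z : bil x (y + z) = bil x y + bil x z.
Proof. by rewrite /bil -trD exprDp1; congr tr; ring. Qed.

Lemma bilZr a x y : bil x (iota a * y) = a * bil x y.
Proof. by rewrite /bil -trZ exprMn iota_expp; congr tr; ring. Qed.

Lemma bilZl a x y : bil (iota a * x) y = a * bil x y.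
Proof. by rewrite bilC bilZr bilC. Qed.

Lemma bil0l x : bil 0 x = 0.
Proof. by have := bilZl 0 0 x; rewrite iota0 !mul0r. Qed.

Lemma bil1 x : bil x 1 = 2 * tr x.
Proof. by rewrite /bil expr1n !mulr1 trD tr_expp mulr2n mulrDl mul1r. Qed.

(* The linear map representing B(u, -) through the trace form. *)
Definition polar (u : F) : F := u ^+ p + u ^+ (p ^ e.-1).

(** The trace is Frobenius invariant, and the power [p ^ e.-1] turns [u * x ^+ p] into
    [u ^+ (p ^ e.-1) * x]. *)
Lemma tr_polar u x : tr (polar u * x) = bil u x.
Proof.
rewrite /bil trD mulrDl trD; congr (_ + _).
rewrite -(tr_exppn (u * x ^+ p) e.-1) exprMn -exprM -expnS prednK //.
by rewrite expf_q.
Qed.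

Lemma polarB u v : polar (u - v) = polar u - polar v.
Proof.
have pN n (x : F) : (- x) ^+ (p ^ n) = - x ^+ (p ^ n).
  by rewrite exprNn -signr_odd oddX p_odd orbT expr1 mulN1r.
by rewrite /polar exprDp1 exprDp -{2}(expn1 p) !pN expn1; ring.
Qed.

Section TwiceOdd.
Hypothesis e_mod4 : (e %% 4 = 2)%N.
Let m := e./2.

Lemma two_neq0F : 2 != 0 :> F.
Proof.
have := Fp_two_neq0 p_pr p_odd; rewrite -iota_eq0 (Fp_incl_nat _ 2) //.
Qed.

(* u^(p^2) = -u iterates to u^(p^(2m)) = (-1)^m u = -u. *)
Lemma polar_eq0 u : polar u = 0 -> u = 0.
Proof.
move=> Lu0; have up2 : u ^+ (p ^ 2) = - u.
  have : polar u ^+ p = 0 by rewrite Lu0 expr0n; case: p p_pr.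
  rewrite exprDp1 -!exprM -expnSr prednK // expf_q mulnn => /eqP.
  by rewrite addr_eq0 => /eqP.
have sgn : (-1) ^+ (p ^ 2) = -1 :> F by rewrite -signr_odd oddX p_odd.
have iter k : u ^+ (p ^ (2 * k)) = (-1) ^+ k * u.
  elim: k => [|k IHk]; first by rewrite mul1r.
  rewrite mulnS addnC expnD exprM IHk exprMn up2 exprS mulrN mulN1r mulNr.
  by rewrite -exprM mulnC exprM sgn.
have := iter m; rewrite (_ : (2 * m)%N = e); last by rewrite /m; lia.
rewrite expf_q -signr_odd (_ : odd m) ?expr1 ?mulN1r; last by rewrite /m; lia.
move/eqP; rewrite -subr_eq0 opprK -mulr2n -mulr_natl mulf_eq0.
by rewrite (negPf two_neq0F) => /eqP.
Qed.

Lemma polar_inj : injective polar.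
Proof.
by move=> u v /eqP; rewrite -subr_eq0 -polarB => /eqP/polar_eq0/subr0_eq.
Qed.

Lemma bilxx u : bil u u = 2 * quad u.
Proof. by rewrite /bil -exprSr -exprS trD /quad mulr2n mulrDl mul1r. Qed.

Lemma exists_prim_root : exists g : F, (p ^ e).-1.-primitive_root g.
Proof.
have q_gt1 : (1 < p ^ e)%N by rewrite -(expn0 p) ltn_exp2l ?prime_gt1.
have /hasP[g _ g_prim] : has (p ^ e).-1.-primitive_root (enum [set~ (0 : F)]).
  apply: has_prim_root; rewrite ?enum_uniq //; first by lia.
    apply/allP=> x; rewrite mem_enum !inE => x0; apply/unity_rootP.
    by apply: (mulfI x0); rewrite -exprS prednK ?expf_q ?mulr1 //; lia.
  by rewrite -cardE cardsC1 cardF.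
by exists g.
Qed.

Lemma dvdn_p2_q : ((p ^ 2).-1 %| (p ^ e).-1)%N.
Proof.
have -> : e = (2 * m)%N by rewrite /m; lia.
by rewrite expnM dvdn_pred_predX.
Qed.

Lemma pred_p2 : (p ^ 2).-1 = (p.-1 * p.+1)%N.
Proof. by have := prime_gt1 p_pr; rewrite -mulnn; nia. Qed.

(** Write [iota a] as [g ^+ k] with [g] a generator. From [a ^+ p.-1 = 1], [p ^ e - 1] divides
    [k * p.-1]; since [e] is even, so does [p.-1 * p.+1], whence [p.+1] divides [k]. *)
Lemma norm_surjective (a : 'F_p) : a != 0 -> exists c : F, c ^+ p.+1 = iota a.
Proof.
move=> a0; have [g g_prim] := exists_prim_root.
have p_gt1 := prime_gt1 p_pr.
have ap1 : iota a ^+ p.-1 = 1 by rewrite -iotaX expf_Fp_pred ?iota1.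
have dvd_q : ((p.-1 * p.+1)%N %| (p ^ e).-1)%N by rewrite -pred_p2 dvdn_p2_q.
have aq1 : iota a ^+ (p ^ e).-1 = 1.
  by case/dvdnP: dvd_q => k ->; rewrite mulnCA mulnC mulnC exprM ap1 expr1n.
have [k def_a] := prim_rootP g_prim aq1.
have : ((p ^ e).-1 %| k * p.-1)%N.
  by rewrite (prim_order_dvd g_prim) exprM -def_a ap1.
move/(dvdn_trans dvd_q); rewrite mulnC dvdn_pmul2r; last by lia.
by case/dvdnP=> l def_k; exists (g ^+ l); rewrite -exprM -def_k.
Qed.

(** * Exponential sums and level sets *)

Section CharacterSums.
Variable zeta : algC.
Hypothesis zeta_prim : p.-primitive_root zeta.
Local Notation psi := (@psi p zeta).
Let psiD := psiD p_pr zeta_prim.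
Let sum_psi := sum_psi p_pr zeta_prim.

(** Nondegeneracy: for [u != 0], a translation by [x0 / polar u] with [tr x0 = 1] raises [bil u] by
    1. *)
Lemma sum_psi_bil u : \sum_x psi (bil u x) = (p ^ e)%:R * (u == 0)%:R.
Proof.
case: eqP => [->|/eqP u0].
  rewrite mulr1 -cardF -sumr_const; apply: eq_bigr => x _.
  by rewrite bil0l.
rewrite mulr0; have [x0 tr_x0] := tr_eq1.
apply: (@sum_psi_eq0 _ p_pr _ zeta_prim _ _ (x0 / polar u)) => x.
rewrite bilDr -(tr_polar u (_ / _)) mulrC divfK ?tr_x0 //.
by apply: contra_neq u0; apply: polar_eq0.
Qed.

Definition gauss (y : 'F_p) := \sum_x psi (y * quad x).

Lemma sum_psi_quad_bil y z u : y != 0 ->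
  \sum_x psi (y * quad x + z * bil u x) = psi (- (z ^+ 2 / y) * quad u) * gauss y.
Proof.
move=> y0; rewrite (reindex_inj (addIr (iota (- (z / y)) * u))) mulr_sumr.
apply: eq_bigr => x _ /=; rewrite -psiD; congr psi.
by rewrite quadD quadZ bilDr !bilZr bilxx (bilC x u); field.
Qed.

Lemma gaussE y : y != 0 -> gauss y = gauss 1.
Proof.
move=> y0; have [c cy] := norm_surjective y0.
have c0 : c != 0.
  by apply: contra_neq y0 => c0; apply/eqP; rewrite -iota_eq0 -cy c0 expr0n.
rewrite [RHS](reindex_inj (mulfI c0)); apply: eq_bigr => x _ /=.
by rewrite mul1r /quad exprMn cy trZ.
Qed.

(** One factor is replaced by the equal sum [gauss (-1)]. After [x = w + y] the terms in [quad y]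
    cancel, and orthogonality in [y] keeps only [w = 0]. *)
Lemma sqr_gauss1 : gauss 1 ^+ 2 = (p ^ e)%:R.
Proof.
rewrite expr2 -{2}(@gaussE (-1)) ?oppr_eq0 ?oner_eq0 // mulr_sumr.
rewrite (eq_bigr (fun y => \sum_w psi (quad w) * psi (bil w y))) /=; last first.
  move=> y _; rewrite mulr_suml (reindex_inj (addIr y)); apply: eq_bigr => w _ /=.
  by rewrite -!psiD; congr psi; rewrite quadD; ring.
rewrite exchange_big /= (eq_bigr (fun w => (w == 0)%:R * ((p ^ e)%:R * psi (quad w)))).
  by rewrite sumr_natb quad0 mulr1.
by move=> w _; rewrite -mulr_sumr sum_psi_bil; ring.
Qed.

(** The condition is detected by a sum over [y]: [y = 0] gives the main term, and all other [y]
    share one Gauss sum. *)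
Lemma card_quad_gauss c :
  p%:R * #|[set x | quad x == c]|%:R
  = (p ^ e)%:R + gauss 1 * (p%:R * (c == 0)%:R - 1).
Proof.
rewrite natr_card_set mulr_sumr.
rewrite (eq_bigr (fun x => \sum_y psi (y * - c) * psi (y * quad x))); last first.
  move=> x _; rewrite -subr_eq0 -sum_psi; apply: eq_bigr => y _.
  by rewrite -psiD; congr psi; ring.
rewrite exchange_big (bigD1 0) //=; congr (_ + _).
  rewrite (eq_bigr (fun=> 1)) ?sumr_const ?cardF // => x _.
  by rewrite !mul0r mulr1.
rewrite (eq_bigr (fun y => psi (y * - c) * gauss 1)) /=; last first.
  by move=> y y0; rewrite -(gaussE y0) mulr_sumr.
rewrite -mulr_suml mulrC; congr (_ * _).
have := sum_psi (- c); rewrite oppr_eq0 => <-.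
by rewrite [in RHS](bigD1 0) //= mul0r psi0 addrAC subrr add0r.
Qed.

Lemma card_quad_bil_gauss u c d : u != 0 ->
  p%:R ^+ 2 * #|[set x | (quad x == c) && (bil u x == d)]|%:R
  = (p ^ e)%:R + gauss 1 *
    (p%:R * #|[set z | quad u * z ^+ 2 + d * z + c == 0]|%:R - p%:R).
Proof.
move=> u0; rewrite !natr_card_set mulr_sumr.
rewrite (eq_bigr (fun x => \sum_y \sum_z psi (- (y * c + z * d)) *
    psi (y * quad x + z * bil u x))); last first.
  move=> x _; rewrite -mulnb natrM expr2 mulrACA -(subr_eq0 (quad x)).
  rewrite -(subr_eq0 (bil u x)) -!sum_psi mulr_suml; apply: eq_bigr => y _.
  rewrite mulr_sumr; apply: eq_bigr => z _.
  by rewrite -!psiD; congr psi; ring.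
(* For [y = 0] only [z = 0] survives, because [u != 0]. *)
rewrite exchange_big (bigD1 0) //=; congr (_ + _).
  rewrite exchange_big /=.
  rewrite (eq_bigr (fun z => (z == 0)%:R * ((p ^ e)%:R * psi (- (z * d))))).
    by rewrite sumr_natb mul0r oppr0 psi0 mulr1.
  move=> z _; have <- : \sum_x psi (bil (iota z * u) x) * psi (- (z * d))
      = (z == 0)%:R * ((p ^ e)%:R * psi (- (z * d))).
    rewrite -mulr_suml sum_psi_bil mulf_eq0 (negPf u0) orbF iota_eq0; ring.
  by apply: eq_bigr => x _; rewrite mulrC bilZl !mul0r !add0r.
rewrite (eq_bigr (fun y => \sum_z gauss 1 *
    psi (y * - (quad u * z ^+ 2 + d * z + c)))); last first.
  (* Replacing [z] by [y * z] makes the phase left by completing the square linear in [y], so that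
     summing over [y] counts roots in [z]. *)
  move=> y y0; rewrite exchange_big /= (reindex_inj (mulfI y0)).
  apply: eq_bigr => z _; rewrite -mulr_sumr sum_psi_quad_bil // (gaussE y0).
  rewrite mulrCA mulrA -psiD mulrC.
  by congr (_ * psi _); field.
rewrite exchange_big /=.
transitivity (\sum_z gauss 1 *
    (p%:R * (quad u * z ^+ 2 + d * z + c == 0)%:R - 1)); last first.
  by rewrite -mulr_sumr sumrB -mulr_sumr sumr_const card_Fp.
apply: eq_bigr => z _; rewrite -mulr_sumr; congr (_ * _).
rewrite -oppr_eq0 -sum_psi [in RHS](bigD1 0) //= mul0r psi0.
by rewrite [RHS]addrC addKr.
Qed.

End CharacterSums.

(* The (p+1)-th roots of unity act freely on the level set. *)
Lemma dvdn_card_quad1 : (p.+1 %| #|[set x | quad x == 1%R]|)%N.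
Proof.
have [g g_prim] := exists_prim_root.
have dvd_q : (p.+1 %| (p ^ e).-1)%N.
  by apply: dvdn_trans dvdn_p2_q; rewrite pred_p2 dvdn_mull.
have h_prim := dvdn_prim_root g_prim dvd_q.
set h := g ^+ _ in h_prim; set A := [set x | _].
rewrite -sum1_card (partition_big_imset (fun x : F => x ^+ p.+1)) /=.
apply: dvdn_sum => _ /imsetP[x0 Ax0 ->].
have qx0 : quad x0 = 1 by move: Ax0; rewrite inE => /eqP.
have x0_neq0 : x0 != 0.
  by apply: contra_eq_neq qx0 => ->; rewrite quad0 eq_sym oner_eq0.
rewrite sum1dep_card (_ : [set x | _] = [set x0 * h ^+ i | i : 'I_p.+1]).
  rewrite card_imset ?card_ord // => i j /(mulfI x0_neq0)/eqP.
  by rewrite (eq_prim_root_expr h_prim) !modn_small ?ltn_ord // => /eqP/val_inj.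
apply/setP=> x; rewrite !inE; apply/andP/imsetP => [[/eqP qx /eqP xx0]|[i _ ->]].
  have : (x / x0) ^+ p.+1 = 1 by rewrite exprMn exprVn xx0 mulfV ?expf_neq0.
  by case/(prim_rootP h_prim)=> i def_x; exists i; rewrite // -def_x mulrC divfK.
have : (x0 * h ^+ i) ^+ p.+1 = x0 ^+ p.+1.
  by rewrite exprMn -exprM mulnC exprM (prim_expr_order h_prim) expr1n mulr1.
by move=> eqx; rewrite eqx /quad eqx -/(quad x0) qx0 !eqxx.
Qed.

(** With the plus sign, [p * #|{Q = 1}|] would be [p ^ e - p ^ m]. Modulo [p.+1] the cardinal is 0,
    [p ^ e] is 1 and, [m] being odd, [p ^ m] is [p]: a contradiction. *)
Lemma gauss1 zeta : p.-primitive_root zeta -> gauss zeta 1 = - (p ^ m)%:R.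
Proof.
move=> zeta_prim; have p_gt1 := prime_gt1 p_pr.
have /eqP : gauss zeta 1 ^+ 2 = (p ^ m)%:R ^+ 2.
  by rewrite sqr_gauss1 // -natrX -expnM; congr (p ^ _)%:R; rewrite /m; lia.
rewrite eqf_sqr => /orP[/eqP g1|/eqP//].
have := card_quad_gauss zeta_prim 1; rewrite g1 oner_eq0 mulr0 sub0r mulrN1.
case/dvdnP: dvdn_card_quad1 => n ->.
have dvd_even k : exists a, (p ^ (2 * k) = a * p.+1 + 1)%N.
  have : (p.+1 %| (p ^ (2 * k)).-1)%N.
    by rewrite expnM; apply: dvdn_trans (dvdn_pred_predX _ _); rewrite pred_p2 dvdn_mull.
  case/dvdnP=> a def_a; exists a; rewrite -def_a addn1 prednK //.
  by rewrite expn_gt0 ltnW.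
have [a def_e] := dvd_even m; have [b def_m] := dvd_even m./2.
have -> : (p ^ e = a * p.+1 + 1)%N by rewrite -def_e /m; congr (p ^ _)%N; lia.
have -> : (p ^ m = (b * p.+1 + 1) * p)%N.
  by rewrite -def_m -expnSr /m; congr (p ^ _)%N; lia.
move/eqP; rewrite eq_sym subr_eq -natrM -natrD eqr_nat => /eqP.
move=> eqN; have /(congr1 (modn^~ p.+1)) : (a * p.+1 + 1 = (p * n + b * p) * p.+1 + p)%N.
  by lia.
by rewrite !modnMDl !modn_small //; lia.
Qed.

Let q2 := (p ^ (m - 1))%N.
Let pe2 := (p ^ (e - 2))%N.

Lemma card_quad c :
  #|[set x | quad x == c]|%:R = p%:R * pe2%:R + q2%:R - p%:R * q2%:R * (c == 0)%:R :> rat.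
Proof.
have [zeta zeta_prim] := C_prim_root_exists (prime_gt0 p_pr).
have p_gt1 := prime_gt1 p_pr.
have := card_quad_gauss zeta_prim c; rewrite gauss1 //.
have -> : (p ^ e = p * (p * pe2))%N by rewrite /pe2 -!expnS; congr (p ^ _)%N; lia.
have -> : (p ^ m = p * q2)%N by rewrite /q2 -expnS; congr (p ^ _)%N; rewrite /m; lia.
set N := #|_|; move=> eqN.
(* Without subtraction the identity descends from [algC] to [nat], and from there passes to
   [rat]. *)
have /eqP : (N + p * q2 * (c == 0%R) = p * pe2 + q2)%N.
  apply/eqP; rewrite -(eqn_pmul2l (ltnW p_gt1)) -(eqr_nat algC).
  by rewrite !(natrD, natrM) mulrDr eqN !natrM; apply/eqP; ring.
rewrite -(eqr_nat rat) !natrD !natrM => /eqP <-; ring.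
Qed.

Lemma card_quad_bil u c d : u != 0 ->
  #|[set x | (quad x == c) && (bil u x == d)]|%:R
  = pe2%:R + q2%:R * (1 - #|[set z | quad u * z ^+ 2 + d * z + c == 0]|%:R) :> rat.
Proof.
move=> u0; have [zeta zeta_prim] := C_prim_root_exists (prime_gt0 p_pr).
have p_gt1 := prime_gt1 p_pr.
have := card_quad_bil_gauss zeta_prim c d u0; rewrite gauss1 //.
have -> : (p ^ e = p ^ 2 * pe2)%N by rewrite /pe2 -expnD; congr (p ^ _)%N; lia.
have -> : (p ^ m = p * q2)%N by rewrite /q2 -expnS; congr (p ^ _)%N; rewrite /m; lia.
set M := #|_|; set R := #|_|; move=> eqM.
have p2_gt0 : (0 < p ^ 2)%N by rewrite expn_gt0 ltnW.
have /eqP : (M + q2 * R = pe2 + q2)%N.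
  apply/eqP; rewrite -(eqn_pmul2l p2_gt0) -(eqr_nat algC).
  by rewrite -mulnn !(natrD, natrM) -expr2 mulrDr eqM -mulnn !natrM; apply/eqP; ring.
rewrite -(eqr_nat rat) !natrD !natrM => /eqP eqM'.
by apply: (addIr (q2%:R * R%:R)); rewrite eqM'; ring.
Qed.

(** * Weights *)

Let Fp2 := Fp_two_neq0 p_pr p_odd.
Let eta_sqr_Fp := eta_mul_sqr Fp2.

Lemma is_sq_Fp_iota t : is_sq_Fp p (iota t) = (eta t == 1).
Proof.
have in_Fp_iota a : in_Fp p (iota a) by apply/in_FpP; exists a.
rewrite /is_sq_Fp in_Fp_iota iota_eq0; case: (etaP Fp2 t) => [->|c c0 ->|t0 nsq].
- by rewrite eqxx.
- rewrite expf_neq0 // eqxx; apply/existsP; exists (iota c).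
  by rewrite in_Fp_iota iotaX eqxx.
rewrite t0 (_ : (-1 == 1 :> rat) = false) //=.
apply/negbTE/existsP => [[_ /andP[/in_FpP[a ->]]]].
by rewrite -iotaX (inj_eq iota_inj) (negPf (nsq a)).
Qed.

Lemma in_C_iota i t : in_C p i (iota t) = (eta t == (-1) ^+ i).
Proof.
have in_Fp_iota : in_Fp p (iota t) by apply/in_FpP; exists t.
case: i; rewrite /in_C is_sq_Fp_iota ?expr0 // iota_eq0 in_Fp_iota -(eta_eq0 Fp2).
by case: etaP.
Qed.

Variable i : bool.
Hypothesis legendre_e : legendre e p = (-1) ^+ i.
Local Notation eF := (e%:R : 'F_p).

Lemma eta_e : eta eF = (-1) ^+ i.
Proof. by rewrite eta_legendre // legendre_e; case: i. Qed.

Lemma e_neq0 : eF != 0.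
Proof. by rewrite -(eta_eq0 Fp2) eta_e signr_eq0. Qed.

Let four_neq0 : 4 != 0 :> 'F_p.
Proof. by have := mulf_neq0 Fp2 Fp2; rewrite -natrM. Qed.

(* After the shift by 1/2, the condition defining D_i bears on c = Q(x): it says
   that c - e/4 and e have the same quadratic character. *)
Definition good (c : 'F_p) := eta (4 * eF * c - eF ^+ 2) == 1.
Let half := iota 2^-1.

(** Since [bil x half = tr x], the linear terms cancel, and the constants give e/4 - e/2 = -e/4.
    Multiplying by [e], whose character is [(-1) ^+ i], removes the dependence on [i]. *)
Lemma in_Dset_shift x : (x + half \in Dset F p e i) = good (quad x).
Proof.
rewrite inE -iota_tr in_C_iota -eta_e /good trD trN -/(quad _).
rewrite quadD -[half]mulr1 bilZr trD trZ bil1 tr1 quadZ quad1.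
have -> : 4 * eF * quad x - eF ^+ 2 = 2 ^+ 2 * ((quad x - eF / 4) * eF).
  by field; rewrite four_neq0.
have eta_e0 : eta eF != 0 by rewrite eta_eq0 ?e_neq0.
have eta_ee : eta eF * eta eF = 1 by rewrite eta_e -expr2 sqrr_sign.
rewrite eta_sqr_Fp // etaM // -[X in _ = (_ == X)]eta_ee (inj_eq (mulIf eta_e0)).
congr (eta _ == _).
by field; rewrite four_neq0 Fp2.
Qed.

(** The shift adds [bil u half = tr u] to [bil u x]. *)
Lemma codeword_shift u x :
  (codeword p e i (polar u) (x + half) != 0) = good (quad x) && (bil u x != - tr u).
Proof.
rewrite ffunE in_Dset_shift; case: (good _); rewrite ?eqxx //=.
rewrite -iota_tr iota_eq0 tr_polar bilDr -[half]mulr1 bilZr bil1.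
by rewrite mulrA mulVf // mul1r addr_eq0.
Qed.

Lemma card_good : \sum_c (good c)%:R = (p%:R - 1) / 2 :> rat.
Proof.
have := card_eta1 Fp2; rewrite card_Fp // => <-; rewrite natr_card_set.
have f_inj : injective (fun c => 4 * eF * c - eF ^+ 2).
  by move=> a b /addIr; apply: mulfI; rewrite mulf_neq0 ?e_neq0.
by rewrite [RHS](reindex_inj f_inj).
Qed.

Let kappa : rat := eta (-1 : 'F_p).
Let pr : rat := p%:R.

(** Level 0 is singled out because it is the only one of exceptional size in [card_quad]. *)
Lemma good0 : good 0 = (kappa == 1).
Proof. by rewrite /good mulr0 sub0r -mulrN1 eta_sqr_Fp ?e_neq0. Qed.

Lemma card_Dset_good : #|Dset F p e i|%:R = \sum_x (good (quad x))%:R :> rat.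
Proof.
rewrite (_ : Dset F p e i = [set x | x \in Dset F p e i]); last first.
  by apply/setP=> x; rewrite inE.
rewrite natr_card_set (reindex_inj (addIr half)).
by apply: eq_bigr => x _ /=; rewrite in_Dset_shift.
Qed.

Lemma card_Dset :
  #|Dset F p e i|%:R =
  (pr - 1) / 2 * (pr * pe2%:R + q2%:R) - pr * q2%:R * (kappa == 1)%:R.
Proof.
rewrite card_Dset_good (sumr_fibre quad (fun c => (good c)%:R)) -card_good -good0.
under eq_bigr => c _ do rewrite card_quad mulrBr.
rewrite sumrB mulr_suml; congr (_ - _).
rewrite -[pr * q2%:R * _](sumr_natb 0 (fun c => pr * q2%:R * (good c)%:R)).
by apply: eq_bigr => c _; ring.
Qed.

Let W : rat := (pr - 1) ^+ 2 / 2 * pe2%:R.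
(* The weight attached to u <> 0, in terms of the quadratic characters
   a = eta (e Q(u)) and b = eta (Tr(u)^2 - e Q(u)). *)
Definition weight_of (a b : rat) : rat :=
  W + q2%:R * ((pr - b - a ^+ 2 + kappa * (pr * (b == 0)%:R - a)) / 2
               - pr * (kappa == 1)%:R).
Let alpha (u : F) := eta (eF * quad u).
Let beta (u : F) := eta (tr u ^+ 2 - eF * quad u).

(** The substitution [z -> - (e / 2) * z] makes [e ^+ 2] a common factor, which [eta] ignores. *)
Lemma card_good_line A T :
  #|[set z | good (- (A * z ^+ 2 - T * z))]|%:R =
  #|[set z : 'F_p | eta (- (eF * A * z ^+ 2 + 2 * T * z + 1)) == 1]|%:R :> rat.
Proof.
rewrite !natr_card_set.
have h_neq0 : - (eF / 2) != 0 by rewrite oppr_eq0 mulf_neq0 ?invr_eq0 ?e_neq0.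
rewrite (reindex_inj (mulfI h_neq0)); apply: eq_bigr => z _ /=.
rewrite /good -[X in _ = (X == 1)%:R](eta_sqr_Fp _ e_neq0).
by congr ((eta _ == 1)%:R); field.
Qed.

(** The weight is the length minus the number of good [x] with [bil u x = - tr u]; these are counted
    level by level with [card_quad_bil]. *)
Lemma wt_polar u : u != 0 ->
  (wt (codeword p e i (polar u)))%:R = weight_of (alpha u) (beta u).
Proof.
move=> u0; rewrite /wt natr_card_set (reindex_inj (addIr half)) /=.
rewrite (eq_bigr (fun x => (good (quad x))%:R -
    (good (quad x))%:R * (bil u x == - tr u)%:R)); last first.
  move=> x _; rewrite codeword_shift -mulnb natrM.
  by case: (bil u x == _); rewrite ?mulr0 ?mulr1 ?subrr ?subr0.
rewrite sumrB -card_Dset_good.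
have -> : \sum_x (good (quad x))%:R * (bil u x == - tr u)%:R =
  \sum_c (good c)%:R * #|[set x | (quad x == c) && (bil u x == - tr u)]|%:R :> rat.
  under [RHS]eq_bigr => c _ do rewrite natr_card_set mulr_sumr.
  rewrite exchange_big; apply: eq_bigr => x _ /=.
  rewrite -(sumr_natb (quad x) (fun c => (good c)%:R * (bil u x == - tr u)%:R)).
  by apply: eq_bigr => c _; rewrite -mulnb natrM eq_sym; ring.
under eq_bigr => c _ do rewrite card_quad_bil // mulrDr mulrCA mulrBr mulr1.
rewrite big_split /= -mulr_suml -mulr_sumr sumrB card_good.
(* Each [z] is a root for exactly one [c], so the double count over [c] and [z] becomes a count over
   [z]. *)
have -> : \sum_c (good c)%:R *
     #|[set z | quad u * z ^+ 2 + - tr u * z + c == 0]|%:R =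
  #|[set z | good (- (quad u * z ^+ 2 - tr u * z))]|%:R :> rat.
  rewrite natr_card_set.
  under eq_bigr => c _ do rewrite natr_card_set mulr_sumr.
  rewrite exchange_big; apply: eq_bigr => z _ /=.
  rewrite -(sumr_natb (- (quad u * z ^+ 2 - tr u * z)) (fun c => (good c)%:R)).
  by apply: eq_bigr => c _; rewrite mulrC mulNr addrC addr_eq0.
rewrite card_good_line card_eta_quadratic // card_Fp // card_Dset.
rewrite /weight_of /W /alpha /beta -/pr -/kappa.
by field.
Qed.

(** * Joint distribution of the two characters *)

Lemma card_quad_tr A T :
  #|[set x | (quad x, tr x) == (A, T)]|%:R
  = pe2%:R - q2%:R * eta (T ^+ 2 - eF * A) :> rat.
Proof.
have -> : [set x | (quad x, tr x) == (A, T)] =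
    [set x | (quad x == A) && (bil 1 x == 2 * T)].
  apply/setP=> x; rewrite !inE xpair_eqE; congr (_ && _).
  by rewrite bilC bil1 (inj_eq (mulfI Fp2)).
rewrite card_quad_bil ?oner_eq0 // quad1.
suff -> : #|[set z | eF * z ^+ 2 + 2 * T * z + A == 0]|%:R =
  1 + eta (T ^+ 2 - eF * A) by ring.
rewrite /eta subrKC !natr_card_set.
(* Completing the square: the square roots of the discriminant are the [e * z + T] with [z] a
   root. *)
rewrite [RHS](reindex_inj (addIr T)) [RHS](reindex_inj (mulfI e_neq0)).
apply: eq_bigr => z _ /=; congr (_%:R).
rewrite -[in RHS]subr_eq0 (_ : _ - _ = eF * (eF * z ^+ 2 + 2 * T * z + A)); last by ring.
by rewrite mulf_eq0 (negPf e_neq0).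
Qed.

(** Group the [u] by [(quad u, tr u)]; then [v = e * quad u] serves as variable, [e] being
    invertible in ['F_p]. *)
Lemma sum_alpha_beta (g : rat -> rat -> rat) :
  \sum_u g (alpha u) (beta u) =
  \sum_T \sum_(v : 'F_p)
     (pe2%:R - q2%:R * eta (T ^+ 2 - v)) * g (eta v) (eta (T ^+ 2 - v)).
Proof.
rewrite (sumr_fibre (fun u => (quad u, tr u))
  (fun s => g (eta (eF * s.1)) (eta (s.2 ^+ 2 - eF * s.1)))) /=.
rewrite (eq_bigr (fun s => g (eta (eF * s.1)) (eta (s.2 ^+ 2 - eF * s.1)) *
   (pe2%:R - q2%:R * eta (s.2 ^+ 2 - eF * s.1)))); last first.
  by case=> A T _; rewrite card_quad_tr.
rewrite -(pair_bigA _ (fun A T => g (eta (eF * A)) (eta (T ^+ 2 - eF * A)) *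
   (pe2%:R - q2%:R * eta (T ^+ 2 - eF * A)))) /= exchange_big.
apply: eq_bigr => T _ /=; rewrite [RHS](reindex_inj (mulfI e_neq0)).
by apply: eq_bigr => A _; rewrite mulrC.
Qed.

Lemma kappaE : kappa = if (p %% 4 == 1)%N then 1 else -1.
Proof. exact: eta_Fp_m1. Qed.

(** This makes the map from [u] to its codeword injective, hence the dimension [e]. Since
    [q2 <= pe2], it suffices to compare the coefficients of [q2]. *)
Lemma weight_of_gt0 (v w : 'F_p) : 0 < weight_of (eta v) (eta w).
Proof.
have p_ge3 : 3 <= pr by rewrite (ler_nat _ 3); have := prime_gt1 p_pr; lia.
have q2_gt0 : 0 < q2%:R :> rat by rewrite ltr0n expn_gt0 prime_gt0.
have le_q2 : q2%:R <= pe2%:R :> rat.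
  by rewrite ler_nat /q2 /pe2 leq_exp2l ?prime_gt1 // /m; lia.
have W_ge : (pr - 1) ^+ 2 / 2 * q2%:R <= W.
  by rewrite ler_wpM2l // mulr_ge0 ?sqr_ge0.
suff [X X_gt] : exists2 X, 0 < (pr - 1) ^+ 2 / 2 + X
    & weight_of (eta v) (eta w) = W + q2%:R * X.
  move=> ->; apply: lt_le_trans (lerD W_ge (lexx _)).
  by rewrite mulrC -mulrDr mulr_gt0.
eexists; last by [].
rewrite kappaE; case: eqP => p4.
  (* Here [X] can be as low as [- (pr + 3) / 2], too low for the bound [3 <= pr] to suffice. *)
  have p_ge5 : 5 <= pr by rewrite (ler_nat _ 5); have := prime_gt1 p_pr; lia.
  by case: (etaP Fp2 v) => [_|? _ _|_ _]; case: (etaP Fp2 w) => [_|? _ _|_ _];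
    rewrite ?eqxx ?oppr_eq0 ?oner_eq0 /=; nra.
by case: (etaP Fp2 v) => [_|? _ _|_ _]; case: (etaP Fp2 w) => [_|? _ _|_ _];
  rewrite ?eqxx ?oppr_eq0 ?oner_eq0 /=; nra.
Qed.

Lemma wt_codeword0 : wt (codeword p e i (polar 0)) = 0%N.
Proof.
rewrite /wt (_ : [set _ | _] = set0) ?cards0 //.
apply/setP=> x; rewrite !inE ffunE -iota_tr tr_polar bil0l.
by rewrite iota0 if_same eqxx.
Qed.

(** If two codewords agree, that of [u - v] has weight 0, so [u = v]. *)
Lemma codeword_polar_inj : injective (codeword p e i \o polar).
Proof.
move=> u v /= eq_uv; apply/eqP; apply: contraT; rewrite -subr_eq0 => uv0.
have := weight_of_gt0 (eF * quad (u - v)) (tr (u - v) ^+ 2 - eF * quad (u - v)).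
rewrite -[weight_of _ _]wt_polar // ltr0n lt0n /wt => /negP[].
rewrite cards_eq0; apply/eqP/setP=> x; rewrite !inE.
have := congr1 (fun c : {ffun F -> F} => c x) eq_uv; rewrite !ffunE.
case: ifP => _; last by rewrite eqxx.
rewrite polarB -!iota_tr => /iota_inj eq_tr.
by rewrite mulrBl trD trN eq_tr subrr iota0 eqxx.
Qed.

Lemma codeE : code F p e i = [set codeword p e i (polar u) | u : F].
Proof.
have [g _ gK] := injF_bij (polar_inj).
apply/setP=> c; apply/imsetP/imsetP => [[a _ ->]|[u _ ->]].
  by exists (g a); rewrite // gK.
by exists (polar u).
Qed.

Lemma card_code : #|code F p e i| = (p ^ e)%N.
Proof. by rewrite codeE card_imset ?cardF //; apply: codeword_polar_inj. Qed.

Lemma card_code_wt w :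
  let ind a b := (weight_of a b == w%:R)%:R in
  #|[set c in code F p e i | wt c == w]|%:R =
    (0 == w%:R :> rat)%:R + (pe2%:R - 1) * ind 0 0
    + (pr - 1) * ((pe2%:R - q2%:R) * ind 0 1 + pe2%:R * ind 1 0)
    + (pr - 1) * (pr - 3) / 4 * (pe2%:R - q2%:R) * ind 1 1
    + (pr - 1) ^+ 2 / 4 *
      ((pe2%:R + q2%:R) * ind 1 (-1) + (pe2%:R - q2%:R) * ind (-1) 1)
    + (pr ^+ 2 - 1) / 4 * (pe2%:R + q2%:R) * ind (-1) (-1) :> rat.
Proof.
move=> ind.
have -> : #|[set c in code F p e i | wt c == w]| =
          #|[set u | wt (codeword p e i (polar u)) == w]|.
  rewrite -(card_imset _ codeword_polar_inj); congr #|pred_of_set _|.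
  apply/setP=> c; rewrite inE codeE; apply/andP/imsetP => [[]|[u]].
    by case/imsetP=> u _ -> wt_u; exists u; rewrite ?inE.
  by rewrite inE => wt_u ->; split=> //; apply: imset_f.
rewrite natr_card_set (bigD1 0) //= wt_codeword0.
(* At [u = 0] both characters are 0, so extending the sum to all [u] adds one [ind 0 0], which is
   subtracted. *)
have -> : \sum_(u | u != 0) (wt (codeword p e i (polar u)) == w)%:R =
    \sum_u ind (alpha u) (beta u) - ind 0 0 :> rat.
  rewrite [in RHS](bigD1 0) //= [X in ind X]/alpha [X in ind _ X]/beta.
  rewrite quad0 tr0 mulr0 expr0n subr0 eta0 [RHS]addrC addKr.
  by apply: eq_bigr => u u0; rewrite /ind -wt_polar // eqr_nat.
rewrite sum_alpha_beta.
rewrite (sum_eta_pairs Fp2 (fun a b => (pe2%:R - q2%:R * b) * ind a b)) card_Fp //.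
by rewrite -(eqr_nat rat) -/pr; field.
Qed.

End TwiceOdd.
End FieldExtension.

(** * The weight table *)

(** A nonzero weight missing from [d] would have frequency 0, yet a codeword attains it. *)
Lemma size_undup_weights (A : finType) (C : {set A}) (f : A -> nat)
    (d : seq (rat * rat)) :
  (forall w, #|[set c in C | f c == w]|%:R
             = \sum_(x <- (0, 1) :: d | x.1 == w%:R) x.2) ->
  (size (undup [seq f c | c <- enum C & f c != 0%N]) <= size d)%N.
Proof.
move=> dist; set s := undup _.
rewrite -(size_map (fun w : nat => w%:R : rat)) -(size_map fst d).
apply: uniq_leq_size.
  rewrite map_inj_uniq ?undup_uniq // => m n /eqP.
  by rewrite eqr_nat => /eqP.
move=> _ /mapP[w w_s ->]; move: w_s; rewrite mem_undup => /mapP[c].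
rewrite mem_filter mem_enum => /andP[fc0 Cc] def_w.
apply: contraT => w_notin; have := dist w.
rewrite big_seq_cond big1 => [/eqP|x /andP[x_d /eqP x1]].
  rewrite pnatr_eq0 cards_eq0 => /eqP/setP/(_ c).
  by rewrite !inE Cc def_w eqxx.
move: x_d; rewrite inE => /orP[/eqP def_x|x_d].
  by move: x1; rewrite def_x def_w => /esym/eqP; rewrite pnatr_eq0 (negPf fc0).
by case/negP: w_notin; rewrite -x1 map_f.
Qed.

(** The dimension is expressed by the number [p ^ e] of codewords. Frequencies are summed over equal
    weights because rows may coincide: for [p = 3], [W + (pr - 3) / 2 * q2] is [W]. *)
Theorem theorem5 (F : finFieldType) (p e : nat) (i : bool) :
  prime p -> odd p -> p \in [pchar F] -> #|F| = (p ^ e)%N ->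
  (0 < e)%N -> (e %% 4 = 2)%N ->
  legendre e p = (-1) ^+ i ->
  let q2 := ((p ^ (e./2 - 1))%N)%:R : rat in
  let pe2 := ((p ^ (e - 2))%N)%:R : rat in
  let pr := (p%:R : rat) in
  let W := (pr - 1) ^+ 2 / 2 * pe2 in
  let C := code F p e i in
  let dist : seq (rat * rat) :=
    if (p %% 4 == 1)%N then
      [:: (0, 1);
          (W, pe2 - 1);
          (W - (pr + 1) / 2 * q2, (pr ^+ 2 - 1) / 2 * pe2 - (pr - 1) * q2);
          (W - (pr + 3) / 2 * q2,
             (pr - 1) * (pr - 3) / 4 * pe2 - (pr - 1) * (pr - 3) / 4 * q2);
          (W - (pr - 1) / 2 * q2, (pr ^+ 2 - 1) / 4 * pe2 + (pr ^+ 2 - 1) / 4 * q2);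
          (W - q2, (pr - 1) * pe2)]
    else
      [:: (0, 1);
          (W, pr * pe2 - 1);
          (W + (pr - 1) / 2 * q2, (pr ^+ 2 - 1) / 2 * pe2);
          (W + (pr - 3) / 2 * q2,
             (pr - 1) ^+ 2 / 4 * pe2 - (pr - 1) ^+ 2 / 4 * q2);
          (W + (pr + 1) / 2 * q2,
             (pr - 1) ^+ 2 / 4 * pe2 + (pr - 1) ^+ 2 / 4 * q2)] in
  [/\ (#|Dset F p e i|)%:R =
        (pr - 1) / 2 * ((p ^ (e - 1))%N)%:R
        - (1 + (eta_m1 p)%:~R * pr) / 2 * q2,
      #|C| = (p ^ e)%N,
      (size (undup [seq wt c | c <- enum C & wt c != 0]) <= 5)%N
    & forall w : nat,
        (#|[set c in C | wt c == w]|)%:R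
        = \sum_(d <- dist | d.1 == w%:R) d.2].
Proof.
move=> p_pr p_odd charFp cardF e_gt0 e_mod4 legendre_e q2 pe2 pr W C dist.
have kappaE := eta_Fp_m1 p_pr p_odd.
have distP w : #|[set c in C | wt c == w]|%:R = \sum_(d <- dist | d.1 == w%:R) d.2.
  rewrite [LHS](card_code_wt charFp) // -/pr -/q2 -/pe2 /dist.
  rewrite big_mkcond /= (eq_bigr (fun d => (d.1 == w%:R)%:R * d.2)); last first.
    by move=> d _; case: ifP => _; rewrite ?mul1r ?mul0r.
  case: (p %% 4 == 1)%N kappaE => kE.
    (* The pairs (0, 1), (1, -1) and (-1, 1) share one weight and merge into one row. *)
    have wE a b : weight_of p e a b =
        W + q2 * ((pr - b - a ^+ 2 + (pr * (b == 0)%:R - a)) / 2 - pr).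
      by rewrite /weight_of kE eqxx mulr1 mul1r.
    have -> : weight_of p e 0 0 = W by rewrite wE /=; field.
    have -> : weight_of p e 0 1 = W - (pr + 1) / 2 * q2 by rewrite wE /=; field.
    have -> : weight_of p e 1 0 = W - q2 by rewrite wE /=; field.
    have -> : weight_of p e 1 1 = W - (pr + 3) / 2 * q2 by rewrite wE /=; field.
    have -> : weight_of p e 1 (-1) = W - (pr + 1) / 2 * q2 by rewrite wE /=; field.
    have -> : weight_of p e (-1) 1 = W - (pr + 1) / 2 * q2 by rewrite wE /=; field.
    have -> : weight_of p e (-1) (-1) = W - (pr - 1) / 2 * q2 by rewrite wE /=; field.
    rewrite !big_cons big_nil /=.
    by field.
  (* Here (1, 0) joins (0, 0), and (0, 1), (1, 1), (-1, -1) merge. *)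
  have wE a b : weight_of p e a b =
      W + q2 * ((pr - b - a ^+ 2 - (pr * (b == 0)%:R - a)) / 2).
    by rewrite /weight_of kE mulr0 subr0 mulN1r.
  have -> : weight_of p e 0 0 = W by rewrite wE /=; field.
  have -> : weight_of p e 0 1 = W + (pr - 1) / 2 * q2 by rewrite wE /=; field.
  have -> : weight_of p e 1 0 = W by rewrite wE /=; field.
  have -> : weight_of p e 1 1 = W + (pr - 1) / 2 * q2 by rewrite wE /=; field.
  have -> : weight_of p e 1 (-1) = W + (pr + 1) / 2 * q2 by rewrite wE /=; field.
  have -> : weight_of p e (-1) 1 = W + (pr - 3) / 2 * q2 by rewrite wE /=; field.
  have -> : weight_of p e (-1) (-1) = W + (pr - 1) / 2 * q2 by rewrite wE /=; field.
  rewrite !big_cons big_nil /=.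
  by field.
split=> //.
- rewrite (card_Dset charFp) // -/pr -/q2 -/pe2 eta_m1E // kappaE.
  have -> : (p ^ (e - 1))%:R = pr * pe2.
    by rewrite /pr /pe2 -natrM -expnS; congr (p ^ _)%:R; lia.
  by case: (p %% 4 == 1)%N; rewrite /=; field.
- exact: (card_code charFp).
(* Apart from the zero weight, the table has five rows in the first case and four in the second. *)
move: distP; rewrite /dist; case: ifP => _ /size_undup_weights // sz.
exact: leq_trans sz _.
Qed.
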